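(* Let $\theta^\infty_1,\theta^\infty_2,\theta^\infty_3\in\mathbb{C}$ be pairwise distinct with $2\theta^\infty_1+\theta^\infty_2+\theta^\infty_3=0$. Let $q_1,p_1,q_2,p_2,v$ be holomorphic functions of $t$ and $U$ a holomorphic $2\times2$-matrix function of $t$ on a domain of $\mathbb{C}$, with $v\neq0$ and $\det U\ne 0$. Put $$Q=\begin{pmatrix} q_1&1\\-q_2&q_1\end{pmatrix},\quad P=\begin{pmatrix} p_1/2&-p_2\\ p_2q_2-\theta^\infty_1-\theta^\infty_2&p_1/2\end{pmatrix},\quad \Theta=\begin{pmatrix}\theta^\infty_2&0\\0&\theta^\infty_3\end{pmatrix},\quad G=U\oplus\mathrm{diag}(v,1),$$ and in $2\times2$ blocks (with $I=I_2$, $O$ the zero block) $$\hat A^{(-3)}=\begin{pmatrix}O&O\\O&I\end{pmatrix},\quad \hat A^{(-2)}=\begin{pmatrix}O&I\\-P+Q^2+tI&O\end{pmatrix},\quad \hat A^{(-1)}=\begin{pmatrix}-P+Q^2+tI&Q\\(P-Q^2-tI)Q-\Theta&P-Q^2\end{pmatrix},\quad \hat B_1=\begin{pmatrix}Q&I\\-P+Q^2+tI&O\end{pmatrix}.$$ Consider the linear systems $$\frac{\partial Y}{\partial x}=A\,Y,\quad A=G^{-1}\left(\hat A^{(-3)}x^2+\hat A^{(-2)}x+\hat A^{(-1)}\right)G,\qquad \frac{\partial Y}{\partial t}=B\,Y,\quad B=G^{-1}\left(\hat A^{(-3)}x+\hat B_1\right)G .$$ Then the compatibility condition $\partial_tA-\partial_xB+[A,B]=O$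 (for all $x$) is equivalent to the Hamiltonian system $$\frac{dq_i}{dt}=\frac{\partial H}{\partial p_i},\qquad \frac{dp_i}{dt}=-\frac{\partial H}{\partial q_i}\quad(i=1,2),\qquad H=\mathrm{tr}\left[P^2-(Q^2+tI)P+(\theta^\infty_1-1)Q\right],$$ together with $$\frac{dU}{dt}=\begin{pmatrix}2(q_1+p_2)&0\\0&0\end{pmatrix}U,\qquad \frac1v\frac{dv}{dt}=2(q_1+p_2).$$
   Context: This is the second matrix Painlevé system $H^{\mathrm{Mat}}_{\mathrm{II}}$, attached to linear systems with a single irregular singularity, at $x=\infty$, of spectral type $(((2)))(((11)))$. $H$ is regarded as a polynomial in $q_1,p_1,q_2,p_2$ (depending on $t$) by inserting the displayed matrices. $\oplus$ denotes block-diagonal sum. *)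

(* Defs.v *)
From HB Require Import structures.
From mathcomp Require Import all_boot all_order all_algebra.
From mathcomp Require Import complex.
From mathcomp Require Import all_classical all_reals all_analysis.

Set Implicit Arguments.
Unset Strict Implicit.
Unset Printing Implicit Defensive.

Import Order.TTheory GRing.Theory Num.Theory.
Import numFieldNormedType.Exports.

Local Open Scope classical_set_scope.
Local Open Scope ring_scope.

                                                                           
                                                                            
                                        
Definition Cplx (R : realType) : numClosedFieldType := R[i].

Section Calculus.
Context {C : numClosedFieldType}.

Definition domain (D : set C) : Prop := [/\ D !=set0, open D & connected D].

Definition holomorphic (D : set C) (f : C -> C) : Prop :=
  forall t, D t -> derivable f t 1.

Definition mx_holomorphic m n (D : set C) (M : C -> 'M[C]_(m, n)) : Prop :=
  forall i j, holomorphic D (fun t => M t i j).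

Definition mx_derive1 m n (M : C -> 'M[C]_(m, n)) (t : C) : 'M[C]_(m, n) :=
  \matrix_(i, j) derive1 (fun s => M s i j) t.

End Calculus.

Section MatrixPainleveII.
Context {C : numClosedFieldType}.

Definition mx2 (a b c d : C) : 'M[C]_2 :=
  \matrix_(i, j) nth 0 (nth [::] [:: [:: a; b]; [:: c; d]] i) j.

Definition Qmx (q1 q2 : C) : 'M[C]_2 := mx2 q1 1 (- q2) q1.

Definition Pmx (th1 th2 p1 q2 p2 : C) : 'M[C]_2 :=
  mx2 (p1 / 2) (- p2) (p2 * q2 - th1 - th2) (p1 / 2).

Definition Thetamx (th2 th3 : C) : 'M[C]_2 := mx2 th2 0 0 th3.

Definition Gmx (U : 'M[C]_2) (v : C) : 'M[C]_(2 + 2) :=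
  block_mx U 0 0 (mx2 v 0 0 1).

                                                                         
Definition Ahat3 : 'M[C]_(2 + 2) := block_mx 0 0 0 1%:M.

Definition Ahat2 (P Q : 'M[C]_2) (t : C) : 'M[C]_(2 + 2) :=
  block_mx 0 1%:M (- P + Q ^+ 2 + t%:M) 0.

Definition Ahat1 (P Q Theta : 'M[C]_2) (t : C) : 'M[C]_(2 + 2) :=
  block_mx (- P + Q ^+ 2 + t%:M)                  Q
           ((P - Q ^+ 2 - t%:M) *m Q - Theta)     (P - Q ^+ 2).

Definition Bhat1 (P Q : 'M[C]_2) (t : C) : 'M[C]_(2 + 2) :=
  block_mx Q 1%:M (- P + Q ^+ 2 + t%:M) 0.

Definition laxA (P Q Theta : 'M[C]_2) (G : 'M[C]_(2 + 2)) (t x : C) :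
    'M[C]_(2 + 2) :=
  invmx G *m (x ^+ 2 *: Ahat3 + x *: Ahat2 P Q t + Ahat1 P Q Theta t) *m G.

Definition laxB (P Q : 'M[C]_2) (G : 'M[C]_(2 + 2)) (t x : C) :
    'M[C]_(2 + 2) :=
  invmx G *m (x *: Ahat3 + Bhat1 P Q t) *m G.

Definition zero_curvature n (A B : C -> C -> 'M[C]_n) (t x : C) : Prop :=
  mx_derive1 (fun s => A s x) t - mx_derive1 (fun y => B t y) x
    + (A t x *m B t x - B t x *m A t x) = 0.

Definition Ham (th1 th2 t q1 p1 q2 p2 : C) : C :=
  let Q := Qmx q1 q2 in
  let P := Pmx th1 th2 p1 q2 p2 in
  \tr (P ^+ 2 - (Q ^+ 2 + t%:M) *m P + (th1 - 1) *: Q).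

Definition hamiltonian_system (H : C -> C -> C -> C -> C -> C)
    (q1 p1 q2 p2 : C -> C) (t : C) : Prop :=
  [/\ derive1 q1 t =   derive1 (fun z => H t (q1 t) z (q2 t) (p2 t)) (p1 t),
      derive1 p1 t = - derive1 (fun z => H t z (p1 t) (q2 t) (p2 t)) (q1 t),
      derive1 q2 t =   derive1 (fun z => H t (q1 t) (p1 t) (q2 t) z) (p2 t) &
      derive1 p2 t = - derive1 (fun z => H t (q1 t) (p1 t) z (p2 t)) (q2 t)].

End MatrixPainleveII.

(* Main.v *)
Require Import Defs.
From HB Require Import structures.
From mathcomp Require Import all_boot all_order all_algebra.
From mathcomp Require Import complex.
From mathcomp Require Import all_classical all_reals all_analysis.
From mathcomp Require Import ring.

Set Implicit Arguments.
Unset Strict Implicit.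
Unset Printing Implicit Defensive.

Import Order.TTheory GRing.Theory Num.Theory.
Import numFieldNormedType.Exports.

Local Open Scope classical_set_scope.
Local Open Scope ring_scope.

(** Write [K = - P + Q^2 + t] for the block that both Lax matrices share. In
    terms of [K] and [Q] the undressed pair is
<<
      A = x^2 (0 0; 0 1) + x (0 1; K 0) + (K  Q; -(K Q + Theta)  t - K),
      B = x (0 0; 0 1) + (Q 1; K 0).
>>
    Conjugating the pair by [G] turns the compatibility condition into
    [A' - B_x + [A, B + G' G^-1] = 0] for the undressed matrices
    ([zero_curvature_gauge]), where [G' G^-1] is block diagonal with blocks
    [W = U' U^-1] and [V = diag (v'/v, 0)]. The left side is a polynomial of
    degree one in [x], so all its coefficient blocks vanish. The coefficient
    of [x] gives [W = V] and an equation for [K'], the constant term gives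
    one for [Q'], and every other block follows from these three
    ([lax_block_compatibility]):
<<
      W = V,   Q' = Q^2 + t - 2 K - [Q, V],   K' = - 2 K Q - Theta - [K, V].
>>
    No shape of [Q] or [K] has entered so far. Now [Q] has the constant entry 1
    in position (1, 2), so that entry of the [Q'] equation carries no derivative:
    it is the algebraic relation [v'/v = 2 (q1 + p2)]. The remaining entries
    are solved successively for [q1'], [q2'], [p1'] and [p2'], which gives
    Hamilton's equations. The converse requires the system to be
    consistent: [Q] and [K] have equal diagonal entries, and so must the
    right-hand sides; for [K] the two diagonal entries differ by
    [2 th1 + th2 + th3 = 0] ([reduced_equationsE]).

    The equivalence holds separately at each point [t]; openness of the domain
    makes [G] invertible near [t], as differentiating [G^-1] requires. *)

(** * Differentiating matrix functions entrywise *)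

Section MatrixCalculus.
Context {K : numFieldType}.
Implicit Types (t : K) (m n p : nat).

Lemma derivable_bigsum (I : Type) (r : seq I) (P : pred I) (f : I -> K -> K) t :
  (forall i, derivable (f i) t 1) ->
  derivable (fun s => \sum_(i <- r | P i) f i s) t 1.
Proof.
move=> df; elim: r => [|i r IH].
  have -> : (fun s => \sum_(i <- [::] | P i) f i s) = cst 0.
    by apply/funext => s; rewrite big_nil.
  exact: derivable_cst.
have -> : (fun s => \sum_(j <- i :: r | P j) f j s) =
    (if P i then f i else cst 0) + (fun s => \sum_(j <- r | P j) f j s).
  apply/funext => s; rewrite big_cons /= fctE; case: (P i) => //.
  by rewrite /cst add0r.
by apply: derivableD IH; case: (P i); [exact: df|exact: derivable_cst].
Qed.

Lemma derivable_bigprod (I : Type) (r : seq I) (f : I -> K -> K) t :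
  (forall i, derivable (f i) t 1) ->
  derivable (fun s => \prod_(i <- r) f i s) t 1.
Proof.
move=> df; elim: r => [|i r IH].
  have -> : (fun s => \prod_(i <- [::]) f i s) = cst 1.
    by apply/funext => s; rewrite big_nil.
  exact: derivable_cst.
have -> : (fun s => \prod_(j <- i :: r) f j s) =
    f i * (fun s => \prod_(j <- r) f j s).
  by apply/funext => s; rewrite big_cons.
exact: derivableM (df i) IH.
Qed.

Lemma derivable_det n (M : K -> 'M[K]_n) t :
  (forall i j, derivable (fun s => M s i j) t 1) ->
  derivable (fun s => \det (M s)) t 1.
Proof.
move=> dM; apply: derivable_bigsum => s.
by apply: derivableM => //; apply: derivable_bigprod => i.
Qed.

Definition mx_is_derive m n (M : K -> 'M[K]_(m, n)) t (dM : 'M[K]_(m, n)) :=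
  forall i j, is_derive t 1 (fun s => M s i j) (dM i j).

Lemma mx_is_derive_unique m n (M : K -> 'M[K]_(m, n)) t dM1 dM2 :
  mx_is_derive M t dM1 -> mx_is_derive M t dM2 -> dM1 = dM2.
Proof.
by move=> d1 d2; apply/matrixP => i j; case: (d1 i j) (d2 i j) => _ <- [_ <-].
Qed.

Lemma mx_is_derive_cst m n (A : 'M[K]_(m, n)) t : mx_is_derive (cst A) t 0.
Proof. by move=> i j; rewrite mxE; apply: is_derive_cst. Qed.

Lemma mx_is_deriveD m n (M N : K -> 'M[K]_(m, n)) t dM dN :
  mx_is_derive M t dM -> mx_is_derive N t dN ->
  mx_is_derive (fun s => M s + N s) t (dM + dN).
Proof.
move=> dMt dNt i j; rewrite mxE.
have -> : (fun s => (M s + N s) i j) = (fun s => M s i j) + (fun s => N s i j).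
  by apply/funext => s; rewrite mxE.
exact: is_deriveD.
Qed.

Lemma mx_is_deriveN m n (M : K -> 'M[K]_(m, n)) t dM :
  mx_is_derive M t dM -> mx_is_derive (fun s => - M s) t (- dM).
Proof.
move=> dMt i j; rewrite mxE.
have -> : (fun s => (- M s) i j) = - (fun s => M s i j).
  by apply/funext => s; rewrite mxE.
exact: is_deriveN.
Qed.

Lemma mx_is_deriveB m n (M N : K -> 'M[K]_(m, n)) t dM dN :
  mx_is_derive M t dM -> mx_is_derive N t dN ->
  mx_is_derive (fun s => M s - N s) t (dM - dN).
Proof. by move=> dMt dNt; apply/mx_is_deriveD/mx_is_deriveN. Qed.

Lemma mx_is_deriveZ m n (a : K -> K) (M : K -> 'M[K]_(m, n)) t da dM :
  is_derive t 1 a da -> mx_is_derive M t dM ->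
  mx_is_derive (fun s => a s *: M s) t (da *: M t + a t *: dM).
Proof.
move=> dat dMt i j; rewrite !mxE addrC mulrC [da * _]mulrC [dM i j * _]mulrC.
have -> : (fun s => (a s *: M s) i j) = a * (fun s => M s i j).
  by apply/funext => s; rewrite mxE.
exact: is_deriveM.
Qed.

Lemma mx_is_deriveM m n p (M : K -> 'M[K]_(m, n)) (N : K -> 'M[K]_(n, p))
    t dM dN :
  mx_is_derive M t dM -> mx_is_derive N t dN ->
  mx_is_derive (fun s => M s *m N s) t (dM *m N t + M t *m dN).
Proof.
move=> dMt dNt i j.
have -> : (fun s => (M s *m N s) i j) =
    \sum_k ((fun s => M s i k) * (fun s => N s k j)).
  by apply/funext => s; rewrite mxE fct_sumE.
have -> : (dM *m N t + M t *m dN) i j =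
    \sum_k (M t i k *: dN k j + N t k j *: dM i k).
  rewrite !mxE -big_split; apply: eq_bigr => k _ /=.
  by rewrite addrC; congr (_ + _); exact: mulrC.
by apply: is_derive_sum => k; apply: is_deriveM.
Qed.

Lemma mx_is_derive_block m1 m2 n1 n2 (Mul : K -> 'M[K]_(m1, n1))
    (Mur : K -> 'M[K]_(m1, n2)) (Mdl : K -> 'M[K]_(m2, n1))
    (Mdr : K -> 'M[K]_(m2, n2)) t dul dur ddl ddr :
  mx_is_derive Mul t dul -> mx_is_derive Mur t dur ->
  mx_is_derive Mdl t ddl -> mx_is_derive Mdr t ddr ->
  mx_is_derive (fun s => block_mx (Mul s) (Mur s) (Mdl s) (Mdr s)) t
    (block_mx dul dur ddl ddr).
Proof.
move=> hul hur hdl hdr i j.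
case: (split_ordP i) => k ->; case: (split_ordP j) => l ->.
- rewrite block_mxEul; under [X in is_derive _ _ X _]funext do rewrite block_mxEul.
  exact: hul.
- rewrite block_mxEur; under [X in is_derive _ _ X _]funext do rewrite block_mxEur.
  exact: hur.
- rewrite block_mxEdl; under [X in is_derive _ _ X _]funext do rewrite block_mxEdl.
  exact: hdl.
- rewrite block_mxEdr; under [X in is_derive _ _ X _]funext do rewrite block_mxEdr.
  exact: hdr.
Qed.

(** Cramer's rule shows that the inverse is differentiable; its derivative then
    comes from differentiating [M *m invmx M = 1]. Invertibility is required on
    a neighbourhood since [invmx] is the identity on singular matrices. *)
Lemma mx_is_derive_invmx n (M : K -> 'M[K]_n) t dM :
  (\forall s \near t, M s \in unitmx) -> mx_is_derive M t dM ->
  mx_is_derive (fun s => invmx (M s)) t (- (invmx (M t) *m dM *m invmx (M t))).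
Proof.
move=> Mu dMt.
have Mut : M t \in unitmx by exact: nbhs_singleton Mu.
have dcof i j : derivable (fun s => cofactor (M s) i j) t 1.
  apply: derivableM => //; apply: derivable_det => k l.
  have -> : (fun s => row' i (col' j (M s)) k l) =
      (fun s => M s (lift i k) (lift j l)) by apply/funext => s; rewrite !mxE.
  by case: (dMt (lift i k) (lift j l)).
have dinv i j : derivable (fun s => invmx (M s) i j) t 1.
  apply: (@near_eq_derivable _ _ _
    ((fun s => (\det (M s))^-1) * (fun s => cofactor (M s) j i))).
    near=> s; rewrite /invmx ifT; last by near: s.
    by rewrite !mxE.
  apply: derivableM => //; apply: derivableV.
    by rewrite -unitfE -unitmxE.
  by apply: derivable_det => k l; case: (dMt k l).
pose dI : 'M[K]_n := \matrix_(i, j) 'D_1 (fun s => invmx (M s) i j) t.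
have dIt : mx_is_derive (fun s => invmx (M s)) t dI.
  by move=> i j; rewrite mxE; apply: derivableP.
have d1 : mx_is_derive (fun s => M s *m invmx (M s)) t 0.
  move=> i j; apply: near_eq_is_derive (mx_is_derive_cst 1%:M t i j).
  by near=> s; rewrite mulmxV //; near: s.
have /esym/(canRL (addKr _)) := mx_is_derive_unique d1 (mx_is_deriveM dMt dIt).
rewrite addr0 => E.
suff <- : dI = - (invmx (M t) *m dM *m invmx (M t)) by [].
by rewrite -[LHS](mulKmx Mut) E mulmxN mulmxA.
Unshelve. all: by end_near. Qed.

End MatrixCalculus.
(** * Removing the gauge, and separating the powers of the spectral variable *)

Section EntriesOfLinearCombinations.
Context {K : pzRingType}.
Variables (m n : nat).
Implicit Types A B : 'M[K]_(m, n).

Lemma mxED A B i j : (A + B) i j = A i j + B i j. Proof. exact: mxE. Qed.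
Lemma mxEN A i j : (- A) i j = - A i j. Proof. exact: mxE. Qed.
Lemma mxEZ (a : K) A i j : (a *: A) i j = a * A i j. Proof. exact: mxE. Qed.
Lemma mxE0 i j : (0 : 'M[K]_(m, n)) i j = 0. Proof. exact: mxE. Qed.

(** Unlike [mxE], these stop at matrix products, so that [ring] on the entries
    decides linear identities between noncommutative monomials. *)
Definition mxE_lin := (mxED, mxEN, mxEZ, mxE0).

End EntriesOfLinearCombinations.

Section ZeroCurvature.
Context {C : numClosedFieldType}.

Lemma mx_derive1_val m n (M : C -> 'M[C]_(m, n)) t dM :
  mx_is_derive M t dM -> mx_derive1 M t = dM.
Proof. by move=> h; apply/matrixP => i j; rewrite mxE derive1E; case: (h i j). Qed.

Lemma mx_derive1P m n (M : C -> 'M[C]_(m, n)) t :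
  (forall i j, derivable (fun s => M s i j) t 1) ->
  mx_is_derive M t (mx_derive1 M t).
Proof. by move=> h i j; rewrite mxE derive1E; apply: derivableP. Qed.

(** Differentiating [invmx G *m A *m G] conjugates [dA + [A, dG *m invmx G]]
    by [G]; the extra commutator is absorbed into [B], and the common
    conjugation drops out of an equation with zero right-hand side. *)
Lemma zero_curvature_gauge n (G : C -> 'M[C]_n) (A B : C -> C -> 'M[C]_n)
    (t x : C) dG dA dB :
  (\forall s \near t, G s \in unitmx) ->
  mx_is_derive G t dG ->
  mx_is_derive (fun s => A s x) t dA ->
  mx_is_derive (fun y => B t y) x dB ->
  zero_curvature (fun s y => invmx (G s) *m A s y *m G s)
    (fun s y => invmx (G s) *m B s y *m G s) t x <->
  dA - dB + (A t x *m (B t x + dG *m invmx (G t))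
             - (B t x + dG *m invmx (G t)) *m A t x) = 0.
Proof.
move=> Gu dGt dAt dBx; have Gt : G t \in unitmx by exact: nbhs_singleton Gu.
rewrite /zero_curvature.
rewrite (mx_derive1_val
  (mx_is_deriveM (mx_is_deriveM (mx_is_derive_invmx Gu dGt) dAt) dGt)).
rewrite (mx_derive1_val
  (mx_is_deriveM (mx_is_deriveM (mx_is_derive_cst (invmx (G t)) x) dBx)
                 (mx_is_derive_cst (G t) x))).
set E := (X in _ <-> X = 0).
set F := (X in X = 0 <-> _).
have FE : F = invmx (G t) *m E *m G t.
  rewrite /F /E /cst mul0mx add0r mulmx0 addr0.
  rewrite !(mulmxDl, mulmxDr, mulNmx, mulmxN, opprD) !mulmxA.
  rewrite !(mulmxK Gt) !(mulmxKV Gt).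
  by apply/matrixP => i j; rewrite !mxE_lin; ring.
split=> [F0|E0]; last by rewrite FE E0 mulmx0 mul0mx.
by rewrite -(mulKVmx Gt E) -[invmx _ *m E](mulmxK Gt) -FE F0 mul0mx mulmx0.
Qed.

Lemma scale_pencil_eq0 m n (M N : 'M[C]_(m, n)) :
  (forall x : C, x *: M + N = 0) <-> M = 0 /\ N = 0.
Proof.
split=> [h|[-> ->] x]; last by rewrite scaler0 addr0.
have N0 : N = 0 by have := h 0; rewrite scale0r add0r.
by have := h 1; rewrite N0 scale1r addr0.
Qed.

(** A noncommutative computation: [K], [Q], [T], [W], [V] are arbitrary square
    blocks subject only to [V *m T = T *m V]. Here [dK] and [dQ] stand for the
    derivatives of [K] and [Q], and [dA] is the resulting derivative of [A].
    The lower left block of the constant term is the consistency condition that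
    holds because [(K Q)'] is determined by [K'] and [Q']. *)
Lemma lax_block_compatibility n (K Q T W V dK dQ : 'M[C]_n) (t : C) :
  V *m T = T *m V ->
  let A x := x ^+ 2 *: block_mx 0 0 0 1%:M + x *: block_mx 0 1%:M K 0
             + block_mx K Q (- (K *m Q + T)) (t%:M - K) in
  let B x := x *: block_mx 0 0 0 1%:M + block_mx Q 1%:M K 0
             + block_mx W 0 0 V in
  let dA x := x *: block_mx 0 0 dK 0
              + block_mx dK dQ (- (dK *m Q + K *m dQ)) (1%:M - dK) in
  (forall x, dA x - block_mx 0 0 0 1%:M + (A x *m B x - B x *m A x) = 0) <->
  [/\ W = V,
      dQ = Q *m Q + t%:M - 2 *: K - (Q *m V - V *m Q) &
      dK = - 2 *: (K *m Q) - T - (K *m V - V *m K)].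
Proof.
move=> VT A B dA.
(* The [x^2] terms cancel; [M] and [N] name the nonzero blocks of the
   coefficients of [x] and of [1], the remaining one being [V - W]. *)
pose M21 := dK + K *m Q + K *m Q + T + K *m W - V *m K.
pose N11 := dK + K *m Q + K *m Q + T + K *m W - W *m K.
pose N12 := dQ + K + K - t%:M - Q *m Q + Q *m V - W *m Q.
pose N21 := - (dK *m Q + K *m dQ) - K *m Q *m Q - T *m Q - K *m Q *m W
  - T *m W + t *: K - K *m K - K *m K + V *m K *m Q + V *m T.
pose N22 := - dK - K *m Q - K *m Q - T - K *m V + V *m K.
have -> : (forall x, dA x - block_mx 0 0 0 1%:M + (A x *m B x - B x *m A x) = 0)
    <-> forall x : C, x *: block_mx 0 (V - W) M21 0 + block_mx N11 N12 N21 N22 = 0.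
  suff E x : dA x - block_mx 0 0 0 1%:M + (A x *m B x - B x *m A x) =
      x *: block_mx 0 (V - W) M21 0 + block_mx N11 N12 N21 N22.
    by split=> h x; rewrite -(h x) E.
  rewrite /A /B /dA !(scale_block_mx, opp_block_mx, add_block_mx, mulmx_block).
  rewrite !(scaler0, addr0, add0r, oppr0).
  rewrite /M21 /N11 /N12 /N21 /N22.
  congr block_mx;
    rewrite !(mul0mx, mulmx0, mulmxDl, mulmxDr, mulNmx, mulmxN, opprD, 
      mul_scalar_mx, mul_mx_scalar, mul1mx, mulmx1);
    rewrite -?(scalemxAl, scalemxAr);
    rewrite !(mul1mx, mulmx1, mul_scalar_mx, mul_mx_scalar) ?mulmxA;
    apply/matrixP => i j; rewrite !mxE_lin; ring.
rewrite scale_pencil_eq0.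
have block_eq0 (X Y Z X' : 'M[C]_n) :
    block_mx X Y Z X' = 0 <-> [/\ X = 0, Y = 0, Z = 0 & X' = 0].
  split=> [E|[-> -> -> ->]]; last exact: block_mx0.
  by apply: eq_block_mx; rewrite E block_mx0.
rewrite !block_eq0 /M21 /N11 /N12 /N21 /N22.
split=> [[[_ /subr0_eq <- M0 _] [_ N0 _ _]]|[-> EQ EK]].
  split=> //; apply: subr0_eq.
    by rewrite -N0; apply/matrixP => i j; rewrite !mxE_lin; ring.
  by rewrite -M0; apply/matrixP => i j; rewrite !mxE_lin; ring.
by split; split; rewrite ?subrr // ?EK ?EQ;
  rewrite ?(mulmxDl, mulmxDr, mulNmx, mulmxN, mul_scalar_mx, mul_mx_scalar);
  rewrite -?(scalemxAl, scalemxAr) ?mulmxA ?VT;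
  apply/matrixP => i j; rewrite !mxE_lin; ring.
Qed.

End ZeroCurvature.

(** * The reduced equations in the canonical coordinates *)

Section CanonicalCoordinates.
Context {C : numClosedFieldType}.
Implicit Types a b c d : C.

Lemma mx2D a b c d a' b' c' d' :
  mx2 a b c d + mx2 a' b' c' d' = mx2 (a + a') (b + b') (c + c') (d + d').
Proof.
by apply/matrixP => [[[|[|i]] hi]] [[|[|j]] hj] //; rewrite !mxE.
Qed.

Lemma mx2N a b c d : - mx2 a b c d = mx2 (- a) (- b) (- c) (- d).
Proof.
by apply/matrixP => [[[|[|i]] hi]] [[|[|j]] hj] //; rewrite !mxE.
Qed.

Lemma mx2Z x a b c d : x *: mx2 a b c d = mx2 (x * a) (x * b) (x * c) (x * d).
Proof.
by apply/matrixP => [[[|[|i]] hi]] [[|[|j]] hj] //; rewrite !mxE.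
Qed.

Lemma mx2M a b c d a' b' c' d' :
  mx2 a b c d *m mx2 a' b' c' d' =
  mx2 (a * a' + b * c') (a * b' + b * d') (c * a' + d * c') (c * b' + d * d').
Proof.
by apply/matrixP => [[[|[|i]] hi]] [[|[|j]] hj] //;
  rewrite !mxE 2!big_ord_recl big_ord0 !mxE /= addr0.
Qed.

Lemma scalar_mx2 a : a%:M = mx2 a 0 0 a.
Proof.
by apply/matrixP => [[[|[|i]] hi]] [[|[|j]] hj] //; rewrite !mxE.
Qed.

Lemma mx2_tr a b c d : \tr (mx2 a b c d) = a + d.
Proof. by rewrite /mxtrace 2!big_ord_recl big_ord0 !mxE addr0. Qed.

Definition mx2E := (scalar_mx2, mx2M, mx2Z, mx2N, mx2D).

Lemma mx2_inj a b c d a' b' c' d' : mx2 a b c d = mx2 a' b' c' d' ->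
  [/\ a = a', b = b', c = c' & d = d'].
Proof.
by move=> /matrixP h; move: (h 0 0) (h 0 1) (h 1 0) (h 1 1); rewrite !mxE.
Qed.

Lemma mx2_congr a b c d a' b' c' d' :
  a = a' -> b = b' -> c = c' -> d = d' -> mx2 a b c d = mx2 a' b' c' d'.
Proof. by move=> -> -> -> ->. Qed.

Lemma mx2_is_derive (a b c d : C -> C) (t da db dc dd : C) :
  is_derive t 1 a da -> is_derive t 1 b db ->
  is_derive t 1 c dc -> is_derive t 1 d dd ->
  mx_is_derive (fun s => mx2 (a s) (b s) (c s) (d s)) t (mx2 da db dc dd).
Proof.
move=> ha hb hc hd [[|[|i]] hi] [[|[|j]] hj] //; rewrite mxE;
  by under [X in is_derive _ _ X _]funext do rewrite mxE.
Qed.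

Lemma mx2_mulV_diag a : a != 0 -> mx2 a 0 0 1 *m mx2 a^-1 0 0 1 = 1%:M.
Proof.
by move=> a0; rewrite !mx2E mulfV //; apply: mx2_congr; ring.
Qed.

Lemma mx2_unit_diag a : a != 0 -> mx2 a 0 0 1 \in unitmx.
Proof. by move=> /mx2_mulV_diag/mulmx1_unit[]. Qed.

Lemma mx2_inv_diag a : a != 0 -> invmx (mx2 a 0 0 1) = mx2 a^-1 0 0 1.
Proof.
move=> a0; have := mulKmx (mx2_unit_diag a0) (mx2 a^-1 0 0 1).
by rewrite mx2_mulV_diag // mulmx1.
Qed.

(** Serves to solve an entry of a matrix equation for one unknown: with the right [k]
    the premise is an identity for [ring] or [field]. *)
Lemma eq_of_proportional (k a b c d : C) : a - b = k * (c - d) -> c = d -> a = b.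
Proof. by move=> h cd; apply: subr0_eq; rewrite h cd subrr mulr0. Qed.

(** Hamilton's equations with the partial derivatives of [Ham] worked out. *)
Definition painleve_equations (th1 th2 t q1 p1 q2 p2 dq1 dp1 dq2 dp2 : C) :=
  [/\ dq1 = p1 - q1 ^+ 2 + q2 - t,
      dp1 = 2 * q1 * p1 + 4 * q2 * p2 - 4 * th1 - 2 * th2 + 2,
      dq2 = 2 * (th1 + th2) - 4 * p2 * q2 - 4 * q1 * q2 &
      dp2 = 2 * p2 ^+ 2 + 4 * q1 * p2 - p1].

(** The (1, 2) entry of the first equation determines [w], as [dQ] vanishes
    there; its first column then yields [dq1] and [dq2], and the first row of the
    second equation [dp1] and [dp2]. Conversely the lower row of the second
    equation is a consequence of the upper one, by the relation on the
    [th]'s. *)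
Lemma reduced_equationsE (th1 th2 th3 t q1 p1 q2 p2 w dq1 dp1 dq2 dp2 : C) :
  2 * th1 + th2 + th3 = 0 ->
  let Q := Qmx q1 q2 in
  let K := - Pmx th1 th2 p1 q2 p2 + Q *m Q + t%:M in
  let V := mx2 w 0 0 0 in
  let dQ := mx2 dq1 0 (- dq2) dq1 in
  let dP := mx2 (dp1 / 2) (- dp2) (dp2 * q2 + p2 * dq2) (dp1 / 2) in
  (dQ = Q *m Q + t%:M - 2 *: K - (Q *m V - V *m Q) /\
   - dP + (dQ *m Q + Q *m dQ) + 1%:M =
     - 2 *: (K *m Q) - Thetamx th2 th3 - (K *m V - V *m K)) <->
  w = 2 * (q1 + p2) /\
  painleve_equations th1 th2 t q1 p1 q2 p2 dq1 dp1 dq2 dp2.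
Proof.
move=> /(canRL (addKr _)); rewrite addr0 => -> Q K V dQ dP.
rewrite /K /V /dQ /dP /Q /Qmx /Pmx /Thetamx /painleve_equations !mx2E.
split=> [[/mx2_inj[a11 a12 a21 _] /mx2_inj[b11 b12 _ _]]|[-> [-> -> -> ->]]].
  (* The factors -1, -2 and 1 below are the inverses of the coefficients with
     which [- w], [- dq2], [- dp1 / 2] and [dp2] enter their entries. *)
  have E1 : w = 2 * (q1 + p2).
    by apply: (@eq_of_proportional (-1) _ _ _ _ _ a12); ring.
  have E2 : dq1 = p1 - q1 ^+ 2 + q2 - t.
    by rewrite a11; field.
  have E3 : dq2 = 2 * (th1 + th2) - 4 * p2 * q2 - 4 * q1 * q2.
    by apply: (@eq_of_proportional (-1) _ _ _ _ _ a21); rewrite E1; ring.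
  split=> //; split=> //.
    by apply: (@eq_of_proportional (-2) _ _ _ _ _ b11); rewrite E2 E3 E1; field.
  by apply: (@eq_of_proportional 1 _ _ _ _ _ b12); rewrite E2 E1; field.
by split; apply: mx2_congr; field.
Qed.

Lemma derive1_quadratic a b c x :
  derive1 (fun z : C => a * z ^+ 2 + b * z + c) x = 2 * a * x + b.
Proof.
rewrite derive1E.
have -> : (fun z : C => a * z ^+ 2 + b * z + c) =
    a \*: (id * id) + b \*: id + cst c by [].
rewrite derive_val /GRing.scale /=; ring.
Qed.

Lemma HamE th1 th2 t q1 p1 q2 p2 : Ham th1 th2 t q1 p1 q2 p2 =
  p1 ^+ 2 / 2 - 2 * p2 ^+ 2 * q2 + 2 * p2 * (th1 + th2) - (q1 ^+ 2 - q2) * p1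
  - 4 * q1 * q2 * p2 + 2 * q1 * (th1 + th2) - t * p1 + 2 * (th1 - 1) * q1 :> C.
Proof.
by rewrite /Ham /Qmx /Pmx !expr2 -!mulmxE !mx2E mx2_tr; field.
Qed.

(** [Ham] has degree at most two in each variable separately, so every partial
    derivative is that of a quadratic polynomial in one variable. *)
Lemma hamiltonian_systemE th1 th2 (q1 p1 q2 p2 : C -> C) t :
  hamiltonian_system (Ham th1 th2) q1 p1 q2 p2 t <->
  painleve_equations th1 th2 t (q1 t) (p1 t) (q2 t) (p2 t)
    (derive1 q1 t) (derive1 p1 t) (derive1 q2 t) (derive1 p2 t).
Proof.
rewrite /hamiltonian_system /painleve_equations.
move: (q1 t) (p1 t) (q2 t) (p2 t) (derive1 q1 t) (derive1 p1 t) (derive1 q2 t)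
  (derive1 p2 t) => {}q1 {}p1 {}q2 {}p2 dq1 dp1 dq2 dp2.
have quad (f : C -> C) x a b c : (forall z, f z = a * z ^+ 2 + b * z + c) ->
    derive1 f x = 2 * a * x + b.
  by move=> /funext ->; rewrite derive1_quadratic.
rewrite (quad _ p1 2^-1 (q2 - q1 ^+ 2 - t)
  (- 2 * p2 ^+ 2 * q2 + 2 * p2 * (th1 + th2) - 4 * q1 * q2 * p2
   + 2 * q1 * (th1 + th2) + 2 * (th1 - 1) * q1)); last first.
  by move=> z; rewrite HamE; field.
rewrite (quad _ q1 (- p1)
  (- 4 * q2 * p2 + 2 * (th1 + th2) + 2 * (th1 - 1))
  (p1 ^+ 2 / 2 - 2 * p2 ^+ 2 * q2 + 2 * p2 * (th1 + th2) + q2 * p1 - t * p1));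
  last first.
  by move=> z; rewrite HamE; field.
rewrite (quad _ p2 (- 2 * q2) (2 * (th1 + th2) - 4 * q1 * q2)
  (p1 ^+ 2 / 2 - (q1 ^+ 2 - q2) * p1 + 2 * q1 * (th1 + th2) - t * p1
   + 2 * (th1 - 1) * q1)); last first.
  by move=> z; rewrite HamE; field.
rewrite (quad _ q2 0 (- 2 * p2 ^+ 2 + p1 - 4 * q1 * p2)
  (p1 ^+ 2 / 2 + 2 * p2 * (th1 + th2) - q1 ^+ 2 * p1 + 2 * q1 * (th1 + th2)
   - t * p1 + 2 * (th1 - 1) * q1)); last first.
  by move=> z; rewrite HamE; field.
by split=> -[-> -> -> ->]; split; field.
Qed.

End CanonicalCoordinates.

(** * The Lax pair of the matrix Painleve system *)

Section LaxPair.
Context {C : numClosedFieldType}.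

(** The equivalence at one point: the lemmas above apply once the derivatives of
    [Q], [P], [K], [G] and of the undressed Lax matrices at [t] are known. *)
Lemma zero_curvature_painleveP (th1 th2 th3 : C) (q1 p1 q2 p2 v : C -> C)
    (U : C -> 'M[C]_2) (t : C) :
  2 * th1 + th2 + th3 = 0 ->
  derivable q1 t 1 -> derivable p1 t 1 ->
  derivable q2 t 1 -> derivable p2 t 1 ->
  derivable v t 1 -> (forall i j, derivable (fun s => U s i j) t 1) ->
  (\forall s \near t, v s != 0 /\ U s \in unitmx) ->
  let Q s := Qmx (q1 s) (q2 s) in
  let P s := Pmx th1 th2 (p1 s) (q2 s) (p2 s) in
  let T := Thetamx th2 th3 in
  let G s := Gmx (U s) (v s) in
  (forall x, zero_curvature (fun s x => laxA (P s) (Q s) T (G s) s x)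
     (fun s x => laxB (P s) (Q s) (G s) s x) t x) <->
  [/\ hamiltonian_system (Ham th1 th2) q1 p1 q2 p2 t,
      mx_derive1 U t = mx2 (2 * (q1 t + p2 t)) 0 0 0 *m U t &
      (v t)^-1 * derive1 v t = 2 * (q1 t + p2 t)].
Proof.
move=> th dq1 dp1 dq2 dp2 dv dU unit_near Q P T G.
have [v0 Ut] : v t != 0 /\ U t \in unitmx by exact: nbhs_singleton unit_near.
have is_der (f : C -> C) : derivable f t 1 -> is_derive t 1 f (derive1 f t).
  by rewrite derive1E; exact: derivableP.
have is_cst (c : C) : is_derive t 1 (fun=> c) 0 by exact: is_derive_cst.
have Gunit : \forall s \near t, G s \in unitmx.
  near=> s.
  have [vs Us] : v s != 0 /\ U s \in unitmx by near: s.
  by rewrite /G /Gmx block_diag_mx_unit Us mx2_unit_diag.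
set dQ := mx2 (derive1 q1 t) 0 (- derive1 q2 t) (derive1 q1 t).
have dQt : mx_is_derive Q t dQ.
  exact: (mx2_is_derive (is_der _ dq1) (is_cst 1)
    (is_deriveN (is_der _ dq2)) (is_der _ dq1)).
set dP := mx2 (derive1 p1 t / 2) (- derive1 p2 t)
  (derive1 p2 t * q2 t + p2 t * derive1 q2 t) (derive1 p1 t / 2).
have half : is_derive t 1 (fun s => p1 s / 2) (derive1 p1 t / 2).
  have -> : (fun s => p1 s / 2) = 2^-1 \*: p1.
    by apply/funext => s; exact: mulrC.
  by rewrite mulrC; exact/is_deriveZ/is_der.
have dp2q2 : is_derive t 1 (fun s => p2 s * q2 s - th1 - th2)
    (derive1 p2 t * q2 t + p2 t * derive1 q2 t).
  have -> : derive1 p2 t * q2 t + p2 t * derive1 q2 t =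
      p2 t *: derive1 q2 t + q2 t *: derive1 p2 t - 0 - 0.
    by rewrite /GRing.scale /=; ring.
  exact: (is_deriveB (is_deriveB (is_deriveM (is_der _ dp2) (is_der _ dq2))
    (is_cst th1)) (is_cst th2)).
have dPt : mx_is_derive P t dP.
  exact: (mx2_is_derive half (is_deriveN (is_der _ dp2)) dp2q2 half).
pose K s := - P s + Q s *m Q s + s%:M.
set dK := - dP + (dQ *m Q t + Q t *m dQ) + 1%:M.
have dscal : mx_is_derive (fun s : C => s%:M : 'M[C]_2) t 1%:M.
  under [X in mx_is_derive X]funext do rewrite scalar_mx2.
  rewrite scalar_mx2.
  exact: (mx2_is_derive (is_derive_id t 1) (is_cst 0) (is_cst 0) (is_derive_id t 1)).
have dKt : mx_is_derive K t dK.
  by apply: mx_is_deriveD dscal; apply: mx_is_deriveD;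
    [exact: mx_is_deriveN|exact: mx_is_deriveM].
pose hatA s x : 'M[C]_(2 + 2) :=
  x ^+ 2 *: Ahat3 + x *: Ahat2 (P s) (Q s) s + Ahat1 (P s) (Q s) T s.
pose hatB s x : 'M[C]_(2 + 2) := x *: Ahat3 + Bhat1 (P s) (Q s) s.
(* Only [K] and [Q] remain visible: [P - Q^2 = t - K]. *)
have hatAE s x : hatA s x =
    x ^+ 2 *: block_mx 0 0 0 1%:M + x *: block_mx 0 1%:M (K s) 0
    + block_mx (K s) (Q s) (- (K s *m Q s + T)) (s%:M - K s).
  rewrite /hatA /Ahat3 /Ahat2 /Ahat1 (expr2 (Q s)) -mulmxE -/(K s).
  have -> : P s - Q s *m Q s - s%:M = - K s by rewrite /K !opprD opprK.
  have -> : P s - Q s *m Q s = s%:M - K s.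
    by rewrite /K !opprD opprK [RHS]addrC subrK.
  by rewrite mulNmx -opprD.
have hatBE s x : hatB s x =
    x *: block_mx 0 0 0 1%:M + block_mx (Q s) 1%:M (K s) 0.
  by rewrite /hatB /Ahat3 /Bhat1 (expr2 (Q s)) -mulmxE -/(K s).
pose dA x : 'M[C]_(2 + 2) := x *: block_mx 0 0 dK 0
  + block_mx dK dQ (- (dK *m Q t + K t *m dQ)) (1%:M - dK).
have dAt x : mx_is_derive (fun s => hatA s x) t (dA x).
  under [X in mx_is_derive X]funext do rewrite hatAE.
  apply: mx_is_deriveD.
    rewrite -[x *: _]add0r; apply: mx_is_deriveD.
      exact: (mx_is_derive_cst (x ^+ 2 *: block_mx 0 0 0 1%:M)).
    rewrite -[x *: _]add0r -(scale0r (block_mx 0 1%:M (K t) 0)).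
    apply: (mx_is_deriveZ (is_cst x)).
    by apply: mx_is_derive_block dKt _; exact: mx_is_derive_cst.
  apply: (mx_is_derive_block dKt dQt _ (mx_is_deriveB dscal dKt)).
  apply: mx_is_deriveN; rewrite -[_ + K t *m dQ]addr0.
  exact: mx_is_deriveD (mx_is_deriveM dKt dQt) (mx_is_derive_cst T t).
have dBx x : mx_is_derive (fun y => hatB t y) x Ahat3.
  have dyA : mx_is_derive (fun y => y *: Ahat3) x (1 *: Ahat3 + x *: 0).
    exact: mx_is_deriveZ (is_derive_id x 1) (mx_is_derive_cst Ahat3 x).
  rewrite scale1r scaler0 in dyA.
  have := mx_is_deriveD dyA (mx_is_derive_cst (Bhat1 (P t) (Q t) t) x).
  by rewrite !addr0.
pose w := (v t)^-1 * derive1 v t.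
pose W := mx_derive1 U t *m invmx (U t).
pose V := mx2 w 0 0 0.
pose dG : 'M[C]_(2 + 2) := block_mx (mx_derive1 U t) 0 0 (mx2 (derive1 v t) 0 0 0).
have dGt : mx_is_derive G t dG.
  apply: mx_is_derive_block; first exact: mx_derive1P.
  - exact: mx_is_derive_cst.
  - exact: mx_is_derive_cst.
  - exact: (mx2_is_derive (is_der _ dv) (is_cst 0) (is_cst 0) (is_cst 1)).
have dGG : dG *m invmx (G t) = block_mx W 0 0 V.
  rewrite /G /Gmx invmx_block_diag -?/(Gmx _ _); last first.
    exact: nbhs_singleton Gunit.
  rewrite /dG mulmx_block mx2_inv_diag // !mul0mx !mulmx0 !addr0 add0r -/W.
  congr block_mx; rewrite mx2M; apply: mx2_congr; rewrite /w; ring.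
have VT : V *m T = T *m V.
  by rewrite /V /T /Thetamx !mx2E; apply: mx2_congr; ring.
have reduced := reduced_equationsE t (q1 t) (p1 t) (q2 t) (p2 t) w
  (derive1 q1 t) (derive1 p1 t) (derive1 q2 t) (derive1 p2 t) th.
have blocks := lax_block_compatibility (K t) (Q t) W dK dQ t VT.
have gauged x := @zero_curvature_gauge _ _ G hatA hatB t x _ _ _
  Gunit dGt (dAt x) (dBx x).
have compat : (forall x, zero_curvature (fun s x => laxA (P s) (Q s) T (G s) s x)
     (fun s x => laxB (P s) (Q s) (G s) s x) t x) <->
  [/\ W = V,
      dQ = Q t *m Q t + t%:M - 2 *: K t - (Q t *m V - V *m Q t) &
      dK = - 2 *: (K t *m Q t) - T - (K t *m V - V *m K t)].
  apply: (iff_trans _ blocks).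
  split=> h x; last by apply/(gauged x); rewrite dGG hatAE hatBE; exact: h.
  by rewrite -[block_mx W 0 0 V]dGG -hatBE -hatAE; exact/(gauged x)/h.
apply: (iff_trans compat); split=> [[EW EQ EK]|[Hh HU Hw]].
  have /reduced[Ew Ep] := conj EQ EK.
  split; [exact/hamiltonian_systemE | | exact: Ew].
  by rewrite -Ew -/V -EW /W mulmxKV.
have /reduced[EQ EK] := conj Hw (proj1 (hamiltonian_systemE _ _ _ _ _ _ _) Hh).
by split=> //; rewrite /W HU -Hw mulmxK.
Unshelve. all: by end_near. Qed.

End LaxPair.

Theorem mainTheorem1 (R : realType) (th1 th2 th3 : Cplx R)
    (D : set (Cplx R)) (q1 p1 q2 p2 v : Cplx R -> Cplx R)
    (U : Cplx R -> 'M[Cplx R]_2) :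
  th1 != th2 -> th1 != th3 -> th2 != th3 ->
  2 * th1 + th2 + th3 = 0 ->
  domain D ->
  holomorphic D q1 -> holomorphic D p1 ->
  holomorphic D q2 -> holomorphic D p2 ->
  holomorphic D v -> mx_holomorphic D U ->
  (forall t, D t -> v t != 0) ->
  (forall t, D t -> \det (U t) != 0) ->
  let Q t := Qmx (q1 t) (q2 t) in
  let P t := Pmx th1 th2 (p1 t) (q2 t) (p2 t) in
  let Theta := Thetamx th2 th3 in
  let G t := Gmx (U t) (v t) in
  let A t x := laxA (P t) (Q t) Theta (G t) t x in
  let B t x := laxB (P t) (Q t) (G t) t x in
  (forall t, D t -> forall x, zero_curvature A B t x) <->
  (forall t, D t ->
    [/\ hamiltonian_system (Ham th1 th2) q1 p1 q2 p2 t,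
        mx_derive1 U t = mx2 (2 * (q1 t + p2 t)) 0 0 0 *m U t &
        (v t)^-1 * derive1 v t = 2 * (q1 t + p2 t)]).
Proof.
move=> _ _ _ th [_ openD _] hq1 hp1 hq2 hp2 hv hU v0 U0 Q P Theta G A B.
suff E t : D t -> (forall x, zero_curvature A B t x) <->
    [/\ hamiltonian_system (Ham th1 th2) q1 p1 q2 p2 t,
        mx_derive1 U t = mx2 (2 * (q1 t + p2 t)) 0 0 0 *m U t &
        (v t)^-1 * derive1 v t = 2 * (q1 t + p2 t)].
  by split=> h t Dt; apply/(E t Dt)/h.
move=> Dt; apply: (zero_curvature_painleveP th (hq1 t Dt) (hp1 t Dt) (hq2 t Dt)
  (hp2 t Dt) (hv t Dt) (fun i j => hU i j t Dt)).
apply: filterS (open_nbhs_nbhs (conj openD Dt)) => s Ds.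
by split; [exact: v0|rewrite unitmxE unitfE; exact: U0].
Qed.
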